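(* Let $M_1,M_2\ge 0$ and let $J(\theta)=\widetilde J(\exp(\theta))$, $\theta\in\mathfrak{se}(3)$, belong to the bounded-$(M_1,M_2)$ class. Then for every $R\ge 1$, $$L_J(R;\mathfrak{se}(3)) \;\le\; \frac{5(\sqrt2+1)}{3}\,(M_1+M_2)\,R^2 .$$ (Here $\tfrac{5(\sqrt2+1)}{3}\approx 4.02$.)
   Context: The Lie algebra $\mathfrak{se}(3)$ consists of the real $4\times4$ matrices $\begin{pmatrix}\Omega & v\\ 0&0\end{pmatrix}$ with $v\in\mathbb{R}^3$ and $\Omega$ a $3\times3$ skew-symmetric matrix with axial vector $\omega\in\mathbb{R}^3$ (i.e. $\Omega x=\omega\times x$). Such an element is identified with $\theta=(\omega,v)\in\mathbb{R}^3\times\mathbb{R}^3=\mathbb{R}^6$, with the 6-vector norm $\|\theta\|_F=(\|\omega\|^2+\|v\|^2)^{1/2}$. $\exp:\mathfrak{se}(3)\to \mathrm{SE}(3)$ is the matrix exponential, where $\mathrm{SE}(3)$ is the group of $4\times 4$ matrices $\begin{pmatrix}Q&t\\0&1\end{pmatrix}$ with $Q\in\mathrm{SO}(3)$, $t\in\mathbb{R}^3$. Bounded-$(M_1,M_2)$ class: $\widetilde J$ is a smooth real-valued function on an open neighbourhood of $\mathrm{SE}(3)$ in $\mathbb{R}^{4\times4}$, with $\nabla\widetilde J$ and $\nabla^2\widetilde J$ its Euclidean gradient and Hessian with respect to the Frobenius inner product on $\mathbb{R}^{4\times 4}$. With $\mathcal{M}_R=\{\exp(\theta):\|\theta\|_F\le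 R\}$, the function $J=\widetilde J\circ\exp$ belongs to the class if for all $R>0$ $$\sup_{g\in\mathcal{M}_R}\|\nabla\widetilde J(g)\|_F\le M_1,\qquad \sup_{g\in\mathcal{M}_R}\|\nabla^2\widetilde J(g)\|_{\mathrm{op}}\le M_2,$$ where $M_1,M_2$ do not depend on $R$, $\|\cdot\|_F$ is the Frobenius norm on matrices, and $\|\cdot\|_{\mathrm{op}}$ is the operator norm. Gradient Lipschitz constant: $\nabla J$ is the gradient of $J$ as a function on $\mathbb{R}^6\cong\mathfrak{se}(3)$ with its Euclidean (6-vector) inner product, and $$L_J(R;\mathfrak{se}(3))=\sup_{\substack{\|\theta\|_F,\|\theta'\|_F\le R\\ \theta\neq\theta'}}\frac{\|\nabla J(\theta)-\nabla J(\theta')\|_F}{\|\theta-\theta'\|_F}.$$ *)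

(* Defs.v *)
From HB Require Import structures.
From mathcomp Require Import all_boot all_order all_algebra.
From mathcomp Require Import all_classical all_reals all_analysis.
From mathcomp Require Import ring.

Set Implicit Arguments.
Unset Strict Implicit.
Unset Printing Implicit Defensive.

Import Order.TTheory GRing.Theory Num.Theory.
Import numFieldNormedType.Exports.

Local Open Scope classical_set_scope.
Local Open Scope ring_scope.

(* The library norm `|A| on 'M[R]_(m, n) is the sup norm of the entries. It is
   only used below through the topology it induces; every quantitative estimate
   is in terms of [frobnorm], which on column vectors is the Euclidean norm. *)
Definition frobdot (R : realType) (m n : nat) (A B : 'M[R]_(m, n)) : R :=
  \sum_i \sum_j A i j * B i j.

Definition frobnorm (R : realType) (m n : nat) (A : 'M[R]_(m, n)) : R :=
  Num.sqrt (frobdot A A).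

Definition opnorm (R : realType) (m n : nat)
    (L : 'M[R]_(m, n) -> 'M[R]_(m, n)) : \bar R :=
  ereal_sup [set (frobnorm (L H))%:E | H in [set H | frobnorm H <= 1]].

(* Gradient for [frobdot]: the [delta_mx i j] form an orthonormal basis;
   see [frobdot_grad]. *)
Definition grad (R : realType) (m n : nat) (f : 'M[R]_(m, n) -> R)
    (x : 'M[R]_(m, n)) : 'M[R]_(m, n) :=
  \matrix_(i, j) 'D_(delta_mx i j) f x.

Definition hess (R : realType) (m n : nat) (f : 'M[R]_(m, n) -> R)
    (x : 'M[R]_(m, n)) : 'M[R]_(m, n) -> 'M[R]_(m, n) :=
  fun H => 'D_H (grad f) x.

Lemma frobdot_grad (R : realType) (m n : nat) (f : 'M[R]_(m, n) -> R)
    (x H : 'M[R]_(m, n)) :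
  differentiable f x -> frobdot (grad f x) H = 'd f x H.
Proof.
move=> df; rewrite {2}[H]matrix_sum_delta linear_sum; apply: eq_bigr => i _.
rewrite linear_sum; apply: eq_bigr => j _.
by rewrite linearZ mxE deriveE// mulrC.
Qed.

(* [Ck k U f]: f is of class C^k on the open set U. Values of f outside U are
   irrelevant. *)
Fixpoint Ck (R : realType) (V : normedModType R) (k : nat) (U : set V)
    (f : V -> R) : Prop :=
  if k is k'.+1 then
    (forall x, U x -> differentiable f x) /\
    (forall v, Ck k' U (fun x => 'D_v f x))
  else forall x, U x -> {for x, continuous f}.

Definition smooth_on (R : realType) (V : normedModType R) (U : set V)
    (f : V -> R) : Prop :=
  forall k, Ck k U f.

Definition expmx (R : realType) (n : nat) (A : 'M[R]_n) : 'M[R]_n :=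
  limn (series (fun k => (k`!%:R : R)^-1 *: (A ^+ k : 'M[R]_n))).

Definition SO3 (R : realType) : set 'M[R]_3 :=
  [set Q | Q^T *m Q = 1%:M /\ \det Q = 1].

Definition SE3 (R : realType) : set 'M[R]_(3 + 1) :=
  [set block_mx Q t (0 : 'M[R]_(1, 3)) (1%:M : 'M[R]_1)
     | Q in @SO3 R & t in [set: 'cV[R]_3]].

Definition cross (R : realType) (a b : 'cV[R]_3) : 'cV[R]_3 :=
  \col_(i < 3) [:: a 1 0 * b 2 0 - a 2 0 * b 1 0;
                   a 2 0 * b 0 0 - a 0 0 * b 2 0;
                   a 0 0 * b 1 0 - a 1 0 * b 0 0]`_i.

Definition skewmat (R : realType) (w : 'cV[R]_3) : 'M[R]_3 :=
  \matrix_(i < 3, j < 3) cross w (delta_mx j 0) i 0.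

Lemma skewmatE (R : realType) (w x : 'cV[R]_3) :
  skewmat w *m x = cross w x.
Proof.
apply/colP => i; rewrite !mxE !big_ord_recl big_ord0 !mxE.
have ordE (a b : 'I_3) : (a == b) = (nat_of_ord a == nat_of_ord b) by [].
have nthE (y : 'cV[R]_3) : exists f : nat -> R, forall k, y k 0 = f k.
  by exists (fun k => y (inord k) 0) => k; rewrite inord_val.
have [[f fE] [g gE]] := (nthE w, nthE x).
rewrite !ordE !fE !gE.
by case: i => [[|[|[|//]]] ?] /=; rewrite /bump /= !modn_small//=
   ?(addn0, addn1, add1n); ring.
Qed.

(* theta = (w, v) in R^3 x R^3 = R^6 *)
Definition se3 (R : realType) (theta : 'cV[R]_(3 + 3)) : 'M[R]_(3 + 1) :=
  block_mx (skewmat (usubmx theta)) (dsubmx theta)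
           (0 : 'M[R]_(1, 3)) (0 : 'M[R]_1).

Definition se3_exp (R : realType) (theta : 'cV[R]_(3 + 3)) : 'M[R]_(3 + 1) :=
  expmx (se3 theta).

Definition MR (R : realType) (r : R) : set 'M[R]_(3 + 1) :=
  [set se3_exp theta | theta in [set theta | frobnorm theta <= r]].

(* [Jt] is total on matrices, but only its restriction to some open
   neighbourhood U of SE(3) is constrained. *)
Definition bounded_class (R : realType) (M1 M2 : R)
    (Jt : 'M[R]_(3 + 1) -> R) : Prop :=
  (exists U : set 'M[R]_(3 + 1),
     [/\ open U, @SE3 R `<=` U & smooth_on U Jt]) /\
  (forall r : R, 0 < r ->
     (ereal_sup [set (frobnorm (grad Jt g))%:E | g in MR r] <= M1%:E)%E /\
     (ereal_sup [set opnorm (hess Jt g) | g in MR r] <= M2%:E)%E).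

Definition grad_lip (R : realType) (J : 'cV[R]_(3 + 3) -> R) (r : R) : \bar R :=
  ereal_sup [set z : \bar R | exists theta theta' : 'cV[R]_(3 + 3),
    [/\ frobnorm theta <= r, frobnorm theta' <= r, theta <> theta' &
        z = (frobnorm (grad J theta - grad J theta')
               / frobnorm (theta - theta'))%:E]].

(* Main.v *)
(* Put E(theta) = exp(se3 theta) and g = E(theta), and let DE(theta) be the
   derivative of E, so that <grad J(theta), k> = <grad Jt(g), DE(theta) k>.

   Since s |-> exp(s A) exp((1 - s) B) has derivative
   exp(s A) (A - B) exp((1 - s) B), the mean value inequality bounds
   P (exp A - exp B) Q by the supremum over s in [0, 1] of the norm of
   P exp(s A) (A - B) exp((1 - s) B) Q. The exponential of an element of se(3)
   of norm at most rho is (Q, t) with Q a rotation and |t| <= rho, and for such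
   rigid motions G, G', G'' and rho >= 1,
     |G (se3 h) G'| <= 2 rho |h|,
     |G (se3 h) G' (se3 k) G''| <= 2 rho |h| |k|.
   Hence |DE(theta) k| <= 2 r |k| and, through second differences of E,
   |DE(theta) k - DE(theta') k| <= 4 r |theta - theta'| |k| on the ball of
   radius r >= 1. Together with |grad Jt(g) - grad Jt(g')| <= 2 r M2
   |theta - theta'|, obtained along the segment from theta' to theta, this
   gives the Lipschitz constant 4 r (M1 + r M2) <= 4 (M1 + M2) r^2, and
   4 <= 5 (sqrt 2 + 1) / 3 because sqrt 2 >= 7 / 5. *)

Require Import Defs.
From HB Require Import structures.
From mathcomp Require Import all_boot all_order all_algebra.
From mathcomp Require Import all_classical all_reals all_analysis.
From mathcomp Require Import ring lra.

Set Implicit Arguments.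
Unset Strict Implicit.
Unset Printing Implicit Defensive.

Import Order.TTheory GRing.Theory Num.Theory.
Import numFieldNormedType.Exports.

Local Open Scope classical_set_scope.
Local Open Scope ring_scope.

(** * The Frobenius inner product *)

Section Frobenius.
Context {R : realType}.

Lemma frobdotE m n (A B : 'M[R]_(m, n)) : frobdot A B = \tr (A^T *m B).
Proof.
rewrite /frobdot exchange_big; apply: eq_bigr => j _.
by rewrite mxE; apply: eq_bigr => i _; rewrite mxE.
Qed.

Lemma frobdotC m n (A B : 'M[R]_(m, n)) : frobdot A B = frobdot B A.
Proof. by apply: eq_bigr => i _; apply: eq_bigr => j _; rewrite mulrC. Qed.

Lemma frobdotDl m n (A B C : 'M[R]_(m, n)) :
  frobdot (A + B) C = frobdot A C + frobdot B C.
Proof. by rewrite !frobdotE linearD mulmxDl linearD. Qed.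

Lemma frobdotZl m n k (A B : 'M[R]_(m, n)) :
  frobdot (k *: A) B = k * frobdot A B.
Proof. by rewrite !frobdotE linearZ -scalemxAl linearZ. Qed.

Lemma frobdotNl m n (A B : 'M[R]_(m, n)) : frobdot (- A) B = - frobdot A B.
Proof. by rewrite -scaleN1r frobdotZl mulN1r. Qed.

Lemma frobdotBl m n (A B C : 'M[R]_(m, n)) :
  frobdot (A - B) C = frobdot A C - frobdot B C.
Proof. by rewrite frobdotDl frobdotNl. Qed.

Lemma frobdotDr m n (A B C : 'M[R]_(m, n)) :
  frobdot A (B + C) = frobdot A B + frobdot A C.
Proof. by rewrite frobdotC frobdotDl !(frobdotC A). Qed.

Lemma frobdotZr m n k (A B : 'M[R]_(m, n)) :
  frobdot A (k *: B) = k * frobdot A B.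
Proof. by rewrite frobdotC frobdotZl frobdotC. Qed.

Lemma frobdotBr m n (A B C : 'M[R]_(m, n)) :
  frobdot A (B - C) = frobdot A B - frobdot A C.
Proof. by rewrite frobdotC frobdotBl !(frobdotC A). Qed.

Lemma frobdot_ge0 m n (A : 'M[R]_(m, n)) : 0 <= frobdot A A.
Proof.
by apply: sumr_ge0 => i _; apply: sumr_ge0 => j _; rewrite -expr2 sqr_ge0.
Qed.

Lemma frobnorm_sqr m n (A : 'M[R]_(m, n)) : frobnorm A ^+ 2 = frobdot A A.
Proof. by rewrite sqr_sqrtr// frobdot_ge0. Qed.

Lemma frobnorm_ge0 m n (A : 'M[R]_(m, n)) : 0 <= frobnorm A.
Proof. exact: sqrtr_ge0. Qed.

Lemma frobnorm_le m n (A : 'M[R]_(m, n)) c :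
  0 <= c -> (frobnorm A <= c) = (frobdot A A <= c ^+ 2).
Proof. by move=> c0; rewrite -frobnorm_sqr ler_sqr ?nnegrE// frobnorm_ge0. Qed.

Lemma sqr_entry_le m n (A : 'M[R]_(m, n)) i j : A i j ^+ 2 <= frobdot A A.
Proof.
rewrite /frobdot (bigD1 i)//= (bigD1 j)//= -expr2 -addrA lerDl addr_ge0//.
  by apply: sumr_ge0 => k _; rewrite -expr2 sqr_ge0.
by apply: sumr_ge0 => l _; apply: sumr_ge0 => k _; rewrite -expr2 sqr_ge0.
Qed.

Lemma entry_le_frobnorm m n (A : 'M[R]_(m, n)) i j : `|A i j| <= frobnorm A.
Proof.
rewrite -ler_sqr ?nnegrE ?frobnorm_ge0// frobnorm_sqr real_normK ?num_real//.
exact: sqr_entry_le.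
Qed.

Lemma frobnorm_eq0 m n (A : 'M[R]_(m, n)) : frobnorm A = 0 -> A = 0.
Proof.
move=> A0; apply/matrixP => i j; rewrite mxE; apply/eqP.
by rewrite -normr_le0 -A0 entry_le_frobnorm.
Qed.

Lemma frobnorm_le0 m n (A : 'M[R]_(m, n)) : frobnorm A <= 0 -> A = 0.
Proof. by move=> A0; apply/frobnorm_eq0/le_anti; rewrite A0 frobnorm_ge0. Qed.

Lemma frobdot0l m n (A : 'M[R]_(m, n)) : frobdot 0 A = 0.
Proof. by rewrite -(scale0r 0) frobdotZl mul0r. Qed.

Lemma frobnorm0 m n : frobnorm (0 : 'M[R]_(m, n)) = 0.
Proof. by rewrite /frobnorm frobdot0l sqrtr0. Qed.

Lemma frobdot_sumr m n (I : finType) (A : 'M[R]_(m, n))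
    (F : I -> 'M[R]_(m, n)) :
  frobdot A (\sum_i F i) = \sum_i frobdot A (F i).
Proof.
by apply: (big_morph _ (frobdotDr A)); rewrite frobdotC frobdot0l.
Qed.

(** The squared norm of [frobdot B B *: A - frobdot A B *: B] is nonnegative and factors as <B,B>
    (<A,A> <B,B> - <A,B>^2); scaling [A] by [frobdot B B] avoids a division. *)
Lemma frobdot_CS m n (A B : 'M[R]_(m, n)) :
  frobdot A B ^+ 2 <= frobdot A A * frobdot B B.
Proof.
have [B0|B0] := eqVneq (frobdot B B) 0.
  have -> : B = 0 by apply: frobnorm_eq0; rewrite /frobnorm B0 sqrtr0.
  by rewrite frobdotC !frobdot0l mulr0 expr0n.
have Bgt0 : 0 < frobdot B B by rewrite lt_def B0 frobdot_ge0.
have := frobdot_ge0 (frobdot B B *: A - frobdot A B *: B).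
rewrite frobdotBl !frobdotBr !frobdotZl !frobdotZr (frobdotC B A).
set a := frobdot A A; set b := frobdot A B; set c := frobdot B B in Bgt0 *.
rewrite [X in 0 <= X](_ : _ = c * (a * c - b ^+ 2)); last by ring.
by rewrite pmulr_rge0// subr_ge0.
Qed.

Lemma frobdot_le m n (A B : 'M[R]_(m, n)) :
  `|frobdot A B| <= frobnorm A * frobnorm B.
Proof.
rewrite -ler_sqr ?nnegrE ?mulr_ge0 ?frobnorm_ge0//.
by rewrite exprMn !frobnorm_sqr real_normK ?num_real ?frobdot_CS.
Qed.

Lemma frobdot_sub_le m n (G G' D D' : 'M[R]_(m, n)) :
  frobdot G D - frobdot G' D' <=
  frobnorm (G - G') * frobnorm D + frobnorm G' * frobnorm (D - D').
Proof.
have -> : frobdot G D - frobdot G' D' =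
    frobdot (G - G') D + frobdot G' (D - D').
  by rewrite frobdotBl frobdotBr addrA subrK.
by apply: lerD; exact: le_trans (ler_norm _) (frobdot_le _ _).
Qed.

Lemma frobnormD m n (A B : 'M[R]_(m, n)) :
  frobnorm (A + B) <= frobnorm A + frobnorm B.
Proof.
rewrite frobnorm_le ?addr_ge0 ?frobnorm_ge0// frobdotDl !frobdotDr.
rewrite (frobdotC B A) -!frobnorm_sqr.
have := le_trans (ler_norm _) (frobdot_le A B); lra.
Qed.

Lemma frobnormZ m n k (A : 'M[R]_(m, n)) :
  frobnorm (k *: A) = `|k| * frobnorm A.
Proof.
apply/eqP; rewrite -(@eqrXn2 _ 2)// ?mulr_ge0 ?frobnorm_ge0//.
rewrite exprMn !frobnorm_sqr real_normK ?num_real//.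
by rewrite frobdotZl frobdotZr mulrA.
Qed.

Lemma frobnormN m n (A : 'M[R]_(m, n)) : frobnorm (- A) = frobnorm A.
Proof. by rewrite -scaleN1r frobnormZ normrN1 mul1r. Qed.

Lemma frobnorm_convex m n (A B : 'M[R]_(m, n)) s r : 0 <= s <= 1 ->
  frobnorm A <= r -> frobnorm B <= r -> frobnorm (A + s *: (B - A)) <= r.
Proof.
move=> /andP[s0 s1] Ar Br.
have -> : A + s *: (B - A) = (1 - s) *: A + s *: B.
  by rewrite scalerBr scalerBl scale1r addrA addrAC.
apply: le_trans (frobnormD _ _) _; rewrite !frobnormZ !ger0_norm ?subr_ge0//.
by have := frobnorm_ge0 A; nra.
Qed.

Lemma frobnormZ_le m n (A : 'M[R]_(m, n)) s rho :
  0 <= s <= 1 -> frobnorm A <= rho -> frobnorm (s *: A) <= rho.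
Proof.
move=> /andP[s0 s1]; rewrite frobnormZ ger0_norm//; apply: le_trans.
by rewrite ler_piMl ?frobnorm_ge0.
Qed.

(** Each entry of the product is the inner product of a row of [A] and a column of [B], so
    Cauchy-Schwarz applies entry by entry and the bounds add up. *)
Lemma frobnormM m n p (A : 'M[R]_(m, n)) (B : 'M[R]_(n, p)) :
  frobnorm (A *m B) <= frobnorm A * frobnorm B.
Proof.
rewrite frobnorm_le ?mulr_ge0 ?frobnorm_ge0// exprMn !frobnorm_sqr.
rewrite [leLHS]/frobdot [X in _ <= X * _]/frobdot mulr_suml.
apply: ler_sum => i _.
rewrite /frobdot exchange_big mulr_sumr; apply: ler_sum => j _.
suff -> : (A *m B) i j = frobdot (row i A) (col j B)^T.
  rewrite -expr2; apply: le_trans (frobdot_CS _ _) _.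
  rewrite /frobdot !big_ord1.
  rewrite le_eqVlt; apply/orP; left; apply/eqP; congr (_ * _);
    by apply: eq_bigr => k _; rewrite !mxE.
by rewrite mxE /frobdot big_ord1; apply: eq_bigr => k _; rewrite !mxE.
Qed.

Lemma frobnorm_orthl m n (Q : 'M[R]_m) (A : 'M[R]_(m, n)) :
  Q^T *m Q = 1%:M -> frobnorm (Q *m A) = frobnorm A.
Proof.
move=> QQ; rewrite /frobnorm !frobdotE trmx_mul mulmxA -(mulmxA A^T) QQ.
by rewrite mulmx1.
Qed.

Lemma frobnormT m n (A : 'M[R]_(m, n)) : frobnorm A^T = frobnorm A.
Proof. by rewrite /frobnorm !frobdotE mxtrace_mulC trmxK. Qed.

Lemma frobnorm_orthr m n (Q : 'M[R]_n) (A : 'M[R]_(m, n)) :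
  Q^T *m Q = 1%:M -> frobnorm (A *m Q) = frobnorm A.
Proof.
move=> /mulmx1C QQ; rewrite -frobnormT trmx_mul frobnorm_orthl ?frobnormT//.
by rewrite trmxK.
Qed.

Lemma frobdot_row m n1 n2 (A : 'M[R]_(m, n1)) (B : 'M[R]_(m, n2)) :
  frobdot (row_mx A B) (row_mx A B) = frobdot A A + frobdot B B.
Proof.
rewrite {1}/frobdot -big_split; apply: eq_bigr => i _; rewrite big_split_ord.
congr (_ + _); apply: eq_bigr => j _.
- by rewrite row_mxEl.
- by rewrite row_mxEr.
Qed.

Lemma frobdot_col m1 m2 n (A : 'M[R]_(m1, n)) (C : 'M[R]_(m2, n)) :
  frobdot (col_mx A C) (col_mx A C) = frobdot A A + frobdot C C.
Proof.
rewrite {1}/frobdot big_split_ord; congr (_ + _);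
  apply: eq_bigr => i _; apply: eq_bigr => j _.
- by rewrite col_mxEu.
- by rewrite col_mxEd.
Qed.

End Frobenius.

(** * Entrywise limits and derivatives of matrix-valued functions *)

Section MatrixLimits.
Context {R : realType}.

Lemma cvg_mxP m n (T : Type) (F : set_system T) {FF : Filter F}
    (f : T -> 'M[R]_(m, n)) (L : 'M[R]_(m, n)) :
  f @ F --> L <-> forall i j, f x i j @[x --> F] --> L i j.
Proof.
split=> [fL i j|fL].
  apply: (@continuous_cvg _ _ _ _ _ f (fun M => M i j)) fL.
  exact: coord_continuous.
apply/cvgrPdist_le => /= e e0; near=> x.
rewrite [leLHS]/Num.Def.normr/= mx_normrE (bigmax_le _ (ltW e0))//= => ij _.
(* There are finitely many entries, so the entrywise bounds hold simultaneously near the limit. *)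
rewrite !mxE; move: ij; near: x; apply: filter_forall => /= ij.
exact: ((cvgrPdist_le _ _).1 (fL ij.1 ij.2)).
Unshelve. all: by end_near. Qed.

Lemma cvg_mx_uniq m n (f g : nat -> 'M[R]_(m, n)) (a b : 'M[R]_(m, n)) :
  f @ \oo --> a -> g @ \oo --> b -> f =1 g -> a = b.
Proof.
by move=> fa gb /funext fg; move: gb; rewrite -fg; exact: cvg_unique.
Qed.

Lemma cvg_mulmx m n p (T : Type) (F : set_system T) {FF : Filter F}
    (f : T -> 'M[R]_(m, n)) (g : T -> 'M[R]_(n, p))
    (A : 'M[R]_(m, n)) (B : 'M[R]_(n, p)) :
  f @ F --> A -> g @ F --> B -> f x *m g x @[x --> F] --> A *m B.
Proof.
move=> /cvg_mxP fA /cvg_mxP gB; apply/cvg_mxP => i j.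
under eq_fun do rewrite mxE; rewrite mxE.
apply: cvg_big => [|k _]; last exact: cvgM.
exact: add_continuous.
Qed.

Lemma is_derive_mxP m n (V : normedModType R) (M : V -> 'M[R]_(m, n)) t v D :
  is_derive t v M D <-> forall i j, is_derive t v (fun x => M x i j) (D i j).
Proof.
split=> [[dM <-] i j|dM].
  have dMij := (derivable_mxP M t v).1 dM i j.
  by rewrite derive_mx// mxE; exact: derivableP.
have dM' : derivable M t v by apply/derivable_mxP => i j; case: (dM i j).
apply: DeriveDef => //; rewrite derive_mx//; apply/matrixP => i j.
by rewrite mxE; case: (dM i j).
Qed.

Lemma is_derive_mulmx m n p (V : normedModType R) (f : V -> 'M[R]_(m, n))
    (g : V -> 'M[R]_(n, p)) t v A B :
  is_derive t v f A -> is_derive t v g B ->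
  is_derive t v (fun x => f x *m g x) (f t *m B + A *m g t).
Proof.
move=> /is_derive_mxP fA /is_derive_mxP gB; apply/is_derive_mxP => i j.
rewrite (_ : (fun x => _) =
  \sum_(k < n) ((fun x => f x i k) * (fun x => g x k j))); last first.
  by apply/funext => x; rewrite fct_sumE mxE.
apply: is_derive_eq.
rewrite !mxE -big_split; apply: eq_bigr => k _ /=.
by rewrite /GRing.scale/= [g t k j * _]mulrC.
Qed.

End MatrixLimits.

(** * The matrix exponential *)

Local Notation expmx_series A := (series (fun k => (k`!%:R)^-1 *: A ^+ k)).

Section MatrixExponential.
Context {R : realType}.

(* Termwise differentiation of the power series with these coefficients replaces
   P by P *m A, so the family is closed under [pseries_diffs]. *)
Definition expmx_coef n (A P : 'M[R]_n) i j (k : nat) : R :=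
  (k`!%:R)^-1 * (P *m A ^+ k) i j.

Lemma frobnorm_mulX n (A P : 'M[R]_n) k :
  frobnorm (P *m A ^+ k) <= frobnorm P * frobnorm A ^+ k.
Proof.
elim: k => [|k IH]; first by rewrite !expr0 mulmx1 mulr1.
rewrite !exprSr mulmxA mulrA; apply: le_trans (frobnormM _ _) _.
by rewrite ler_wpM2r ?frobnorm_ge0.
Qed.

(** Comparison with the scalar exponential series, which converges everywhere; this yields absolute
    convergence for every [x]. *)
Lemma expmx_coef_le n (A P : 'M[R]_n) i j x k :
  `|expmx_coef A P i j k * x ^+ k| <=
  frobnorm P * exp_coeff (frobnorm A * `|x|) k.
Proof.
rewrite /expmx_coef !normrM normfV normr_nat normrX.
rewrite [leRHS](_ : _ =
  (k`!%:R)^-1 * (frobnorm P * frobnorm A ^+ k) * `|x| ^+ k);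
  last by rewrite /exp_coeff /= exprMn; ring.
rewrite ler_wpM2r ?exprn_ge0// ler_wpM2l ?invr_ge0//.
exact: le_trans (entry_le_frobnorm _ _ _) (frobnorm_mulX _ _ _).
Qed.

Lemma is_cvg_exp_majorant (c y : R) :
  cvgn (series (fun k => c * exp_coeff y k)).
Proof. exact/is_cvg_seriesZ/is_cvg_series_exp_coeff. Qed.

Lemma is_cvg_expmx_coef_norm n (A P : 'M[R]_n) i j x :
  cvgn (series (fun k => `|expmx_coef A P i j k * x ^+ k|)).
Proof.
have := @is_cvg_exp_majorant (frobnorm P) (frobnorm A * `|x|).
apply: series_le_cvg => k.
- exact: normr_ge0.
- by rewrite mulr_ge0 ?frobnorm_ge0 ?exp_coeff_ge0 ?mulr_ge0 ?frobnorm_ge0.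
- exact: expmx_coef_le.
Qed.

Lemma is_cvg_expmx_coef n (A P : 'M[R]_n) i j x :
  cvgn (pseries (expmx_coef A P i j) x).
Proof. exact/normed_cvg/is_cvg_expmx_coef_norm. Qed.

Lemma expmx_coef_diffs n (A P : 'M[R]_n) i j :
  pseries_diffs (expmx_coef A P i j) = expmx_coef A (P *m A) i j.
Proof.
apply/funext => k; rewrite /pseries_diffs /expmx_coef factS natrM invfM.
by rewrite exprS mulmxA mulrA mulVKf.
Qed.

Lemma cvg_expmx n (A : 'M[R]_n) :
  expmx_series A @ \oo --> expmx A.
Proof.
have cv : expmx_series A @ \oo -->
    (\matrix_(i, j) limn (pseries (expmx_coef A 1%:M i j) 1) : 'M[R]_n).
  apply/cvg_mxP => i j; rewrite mxE.
  rewrite (_ : (fun N => _) = pseries (expmx_coef A 1%:M i j) 1);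
    first exact: is_cvg_expmx_coef.
  apply/funext => N; rewrite /series /= summxE; apply: eq_bigr => k _.
  by rewrite /expmx_coef/= mul1mx expr1n mulr1 mxE.
(* [expmx A] is defined as a [limn], so it can be identified with the entrywise limit only once
   convergence is known. *)
by move: (cv); rewrite -(cvg_lim _ cv).
Qed.

Arguments cvg_expmx {n} A.

Lemma exprZmx n (A : 'M[R]_n) s k : (s *: A) ^+ k = s ^+ k *: A ^+ k.
Proof.
elim: k => [|k IH]; first by rewrite !expr0 scale1r.
by rewrite !exprS IH -[LHS]scalemxAl -scalemxAr scalerA.
Qed.

(** The entries are scalar power series in [s]. The factor [P] is there because differentiating the
    case [P = 1%:M] gives the case [P = A]. *)
Lemma mulmx_expmxE n (A P : 'M[R]_n) s i j :
  (P *m expmx (s *: A)) i j = limn (pseries (expmx_coef A P i j) s).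
Proof.
apply/esym/cvg_lim => //.
have /cvg_mxP/(_ i j) : P *m expmx_series (s *: A) N @[N --> \oo] -->
    P *m expmx (s *: A) by exact: cvg_mulmx (cvg_cst P) (cvg_expmx _).
apply: cvg_trans; apply: near_eq_cvg; near=> N.
rewrite /pseries /series /= mulmx_sumr summxE; apply: eq_bigr => k _.
rewrite /= exprZmx scalerA -scalemxAr mxE.
by rewrite /expmx_coef; ring.
Unshelve. all: by end_near. Qed.

Lemma expmxE n (A : 'M[R]_n) s i j :
  expmx (s *: A) i j = limn (pseries (expmx_coef A 1%:M i j) s).
Proof. by rewrite -mulmx_expmxE mul1mx. Qed.

Lemma entry_expmx_le n (A : 'M[R]_n) i j :
  `|expmx A i j| <= frobnorm (1%:M : 'M[R]_n) * expR (frobnorm A).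
Proof.
rewrite -[A in expmx A]scale1r expmxE.
have cv := @is_cvg_expmx_coef_norm _ A 1%:M i j 1.
apply: le_trans (lim_series_norm cv) _.
have ce : cvgn (series (exp_coeff (frobnorm A))).
  exact: is_cvg_series_exp_coeff.
rewrite /expR -[leRHS](lim_seriesZ _ ce).
apply: lim_series_le => //; first exact: is_cvg_exp_majorant.
by move=> k; have := expmx_coef_le A 1%:M i j 1 k; rewrite normr1 mulr1.
Qed.

Lemma is_derive_expmxZ n (A : 'M[R]_n) (s : R) :
  is_derive s 1 (fun x => expmx (x *: A)) (A *m expmx (s *: A)).
Proof.
apply/is_derive_mxP => i j.
rewrite mulmx_expmxE (_ : expmx_coef A A i j =
  pseries_diffs (expmx_coef A 1%:M i j)); last first.
  by rewrite expmx_coef_diffs mul1mx.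
rewrite (_ : (fun x => _) =
  fun x => limn (pseries (expmx_coef A 1%:M i j) x)); last first.
  by apply/funext => x; rewrite expmxE.
(* The radius only has to exceed the modulus of [s], since all the series involved converge
   everywhere. *)
apply: (@pseries_snd_diffs _ _ (`|s| + 1));
  rewrite ?expmx_coef_diffs; try exact: is_cvg_expmx_coef.
by rewrite [ltRHS]ger0_norm ?addr_ge0// ltrDl.
Qed.

Lemma expmx_comm n (A B : 'M[R]_n) :
  A *m B = B *m A -> B *m expmx A = expmx A *m B.
Proof.
move=> AB.
have cl : B *m expmx_series A N @[N --> \oo] --> B *m expmx A.
  exact: cvg_mulmx (cvg_cst B) (cvg_expmx A).
have cr : expmx_series A N *m B @[N --> \oo] --> expmx A *m B.
  exact: cvg_mulmx (cvg_expmx A) (cvg_cst B).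
apply: (cvg_mx_uniq cl cr) => N; rewrite /series /= mulmx_sumr mulmx_suml.
apply: eq_bigr => k _; rewrite -scalemxAr -scalemxAl; congr (_ *: _).
elim: k => [|k IH]; first by rewrite expr0 mulmx1 mul1mx.
by rewrite exprS mulmxA -AB -mulmxA IH mulmxA.
Qed.

Lemma expmx0 n : expmx (0 : 'M[R]_n) = 1%:M.
Proof.
rewrite -(scale0r 0); apply/matrixP => i j; rewrite expmxE.
(* At 0 only the term of index 0 survives, with 0^0 = 1, so the partial sums are constant once they
   are nonempty. *)
apply/cvg_lim => //; apply: cvg_near_cst; near=> N.
have N0 : (0 < N)%N by near: N; exact: nbhs_infty_gt.
rewrite /pseries /series /= big_ltn// expr0 mulr1 big1_seq ?addr0.
  by rewrite /expmx_coef fact0 invr1 mul1r expr0 mulmx1.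
move=> k /andP[_]; rewrite mem_index_iota => /andP[k0 _].
by rewrite expr0n gtn_eqF// mulr0.
Unshelve. all: by end_near. Qed.

End MatrixExponential.
Arguments cvg_expmx {R n} A.

(** * Directional derivatives of the matrix exponential *)

Section ExponentialDerivative.
Context {R : realType}.

(* The upper right block of exp [[A, K], [0, A + eK]] is
   (exp (A + eK) - exp A) / e, so differentiability of exp at A along K reduces
   to continuity of exp on matrices of twice the size. *)
Fixpoint upper_pow n (A K B : 'M[R]_n) k : 'M[R]_n :=
  if k is k'.+1 then A *m upper_pow A K B k' + K *m B ^+ k' else 0.

Lemma block_mxX n (A K B : 'M[R]_n) k :
  (block_mx A K 0 B : 'M[R]_(n + n)) ^+ k =
  block_mx (A ^+ k) (upper_pow A K B k) 0 (B ^+ k).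
Proof.
elim: k => [|k IH]; first by rewrite !expr0 -scalar_mx_block.
rewrite !exprS IH [LHS]mulmx_block !(mul0mx, mulmx0, addr0, add0r).
by [].
Qed.

Lemma upper_pow_linear n (A B : 'M[R]_n) k :
  linear (fun K => upper_pow A K B k).
Proof.
move=> c K L; elim: k => [|k IH] /=; first by rewrite scaler0 addr0.
rewrite IH mulmxDr mulmxDl scalerDr -!scalemxAr -!scalemxAl.
by rewrite addrACA.
Qed.

(** Both sides vanish at [k = 0] and satisfy the recurrence X_{k+1} = A X_k + e K (A + e K)^k. *)
Lemma upper_pow_sub n (A K : 'M[R]_n) e k :
  e *: upper_pow A K (A + e *: K) k = (A + e *: K) ^+ k - A ^+ k.
Proof.
elim: k => [|k IH] /=; first by rewrite scaler0 !expr0 subrr.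
rewrite scalerDr scalemxAr IH mulmxBr !exprS mulrDl scalemxAl.
by rewrite addrAC.
Qed.

Local Notation upper_series A K B :=
  (series (fun k => (k`!%:R)^-1 *: upper_pow A K B k)).

Lemma cvg_ursub_expmx n (A K B : 'M[R]_n) :
  upper_series A K B @ \oo -->
  ursubmx (expmx (block_mx A K 0 B : 'M[R]_(n + n))).
Proof.
have /cvg_mxP cv := cvg_expmx (block_mx A K 0 B : 'M[R]_(n + n)).
apply/cvg_mxP => i j; rewrite !mxE; apply: cvg_trans (cv _ _).
apply: near_eq_cvg; near=> N.
rewrite /series /= !summxE; apply: eq_bigr => k _.
by rewrite block_mxX [LHS]mxE [RHS]mxE block_mxEur.
Unshelve. all: by end_near. Qed.
Arguments cvg_ursub_expmx {n} A K B.

(** [upper_pow_sub] summed over the series. Multiplying by [e] instead of dividing keeps the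
    identity valid at [e = 0]. *)
Lemma ursub_expmx_sub n (A K : 'M[R]_n) e :
  e *: ursubmx (expmx (block_mx A K 0 (A + e *: K) : 'M[R]_(n + n))) =
  expmx (A + e *: K) - expmx A.
Proof.
have cl : e *: upper_series A K (A + e *: K) N @[N --> \oo] -->
    e *: ursubmx (expmx (block_mx A K 0 (A + e *: K) : 'M[R]_(n + n))).
  by apply: cvgZl_tmp; exact: cvg_ursub_expmx.
have cr : expmx_series (A + e *: K) N - expmx_series A N @[N --> \oo] -->
    expmx (A + e *: K) - expmx A.
  exact: cvgB (cvg_expmx _) (cvg_expmx _).
apply: (cvg_mx_uniq cl cr) => N; rewrite /series /= -sumrB scaler_sumr.
apply: eq_bigr => k _.
by rewrite -scalerBr -upper_pow_sub !scalerA mulrC.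
Qed.

(** The block of [ursub_expmx_sub] at [e = 0], that is, the limit of the difference quotients of the
    exponential at [A] along [K]. *)
Definition dexpmx n (A K : 'M[R]_n) : 'M[R]_n :=
  ursubmx (expmx (block_mx A K 0 A : 'M[R]_(n + n))).

(** Linearity in [K] is visible on the blocks of the powers, not on the exponential of the block
    matrix, so it is proved on partial sums and passed to the limit. *)
Lemma dexpmx_linear n (A : 'M[R]_n) : linear (dexpmx A).
Proof.
move=> c K L.
have cl : c *: upper_series A K A N + upper_series A L A N @[N --> \oo] -->
    c *: dexpmx A K + dexpmx A L.
  apply: cvgD; last exact: cvg_ursub_expmx.
  by apply: cvgZl_tmp; exact: cvg_ursub_expmx.
have cr := cvg_ursub_expmx A (c *: K + L) A.
apply: (cvg_mx_uniq cr cl) => N; rewrite /series /= scaler_sumr -big_split.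
apply: eq_bigr => k _ /=.
by rewrite upper_pow_linear scalerDr !scalerA mulrC.
Qed.

HB.instance Definition _ n (A : 'M[R]_n) :=
  GRing.isLinear.Build R 'M[R]_n 'M[R]_n _ (dexpmx A) (dexpmx_linear A).

Lemma expmx_line_bound n (A K : 'M[R]_n) : exists2 M, 0 <= M & forall e i j,
  `|e| <= 1 -> `|expmx (A + e *: K) i j| <= M.
Proof.
exists (frobnorm (1%:M : 'M[R]_n) * expR (frobnorm A + frobnorm K)).
  by rewrite mulr_ge0 ?frobnorm_ge0 ?expR_ge0.
move=> e i j e1; apply: le_trans (entry_expmx_le _ _ _) _.
rewrite ler_wpM2l ?frobnorm_ge0// ler_expR.
apply: le_trans (frobnormD _ _) _; rewrite lerD2l frobnormZ.
by rewrite ler_piMl ?frobnorm_ge0.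
Qed.

(** The increment is [e] times a block of an exponential of twice the size. As [e] varies, that
    larger matrix runs along a line too, so [expmx_line_bound] applies to it. *)
Lemma expmx_line_lipschitz n (A K : 'M[R]_n) : exists2 M, 0 <= M & forall e i j,
  `|e| <= 1 -> `|expmx (A + e *: K) i j - expmx A i j| <= `|e| * M.
Proof.
have [M M0 AM] := expmx_line_bound (block_mx A K 0 A : 'M[R]_(n + n))
  (block_mx 0 0 0 K).
exists M => // e i j e1.
have /matrixP/(_ i j) := ursub_expmx_sub A K e; rewrite !mxE => <-.
rewrite normrM ler_wpM2l//.
have := AM e (lshift n i) (rshift n j) e1.
by rewrite scale_block_mx add_block_mx !scaler0 !addr0.
Qed.

(** The difference quotient at [h] is the upper right block of an exponential of twice the size,
    taken along a line in [h]. The Lipschitz bound on that line puts it within |h| M of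
    [dexpmx A K]. *)
Lemma is_derive_expmx n (A K : 'M[R]_n) :
  is_derive A K (@expmx R n) (dexpmx A K).
Proof.
have [M M0 AM] := expmx_line_lipschitz (block_mx A K 0 A : 'M[R]_(n + n))
  (block_mx 0 0 0 K).
suff cv : h^-1 *: (expmx (h *: K + A) - expmx A) @[h --> 0^'] --> dexpmx A K.
  by apply: DeriveDef; [apply/cvg_ex; exists (dexpmx A K)|exact: cvg_lim cv].
apply/cvg_mxP => i j; apply/cvgrPdist_le => /= e e0.
have M1 : 0 < M + 1 by rewrite ltr_wpDl.
near=> h.
have h0 : h != 0 by near: h; exact: nbhs_dnbhs_neq.
have h1 : `|h| <= 1 by near: h; exact: dnbhs0_le.
have he : `|h| <= e / (M + 1) by near: h; apply: dnbhs0_le; rewrite divr_gt0.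
rewrite [h *: K + A]addrC -ursub_expmx_sub scalerA mulVf// scale1r distrC !mxE.
have := AM h (lshift n i) (rshift n j) h1.
rewrite scale_block_mx add_block_mx !scaler0 !addr0 => /le_trans; apply.
move: he; rewrite ler_pdivlMr// => /(le_trans _); apply.
by rewrite ler_wpM2l// lerDl.
Unshelve. all: by end_near. Qed.

End ExponentialDerivative.

(** * Mean value inequalities *)

Lemma subrACA (V : zmodType) (a b c d : V) : a - b - (c - d) = a - c - (b - d).
Proof.
by rewrite !opprB addrACA [RHS]addrACA; congr (_ + _); rewrite addrC.
Qed.

Section MeanValue.
Context {R : realType}.

Lemma is_derive_frobdot m n (V : normedModType R) (F : V -> 'M[R]_(m, n))
    t v D W :
  is_derive t v F D ->
  is_derive t v (fun x => frobdot (F x) W) (frobdot D W).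
Proof.
move=> /is_derive_mxP FD.
rewrite (_ : (fun x => _) =
    \sum_(i < m) \sum_(j < n) ((W i j) *: (fun x => F x i j))).
  apply: is_derive_eq; apply: eq_bigr => i _; apply: eq_bigr => j _.
  by rewrite mulrC.
apply/funext => x; rewrite fct_sumE; apply: eq_bigr => i _.
by rewrite fct_sumE; apply: eq_bigr => j _; rewrite mulrC.
Qed.

(** The scalar mean value theorem applies to the pairing of [F] with the fixed matrix W = F b - F a;
    Cauchy-Schwarz then allows one factor |W| to be cancelled. *)
Lemma mean_value_frobnorm m n (F D : R -> 'M[R]_(m, n)) (a b C : R) :
  a <= b -> (forall s : R, is_derive s (1 : R) F (D s)) ->
  (forall s, a <= s <= b -> frobnorm (D s) <= C) ->
  frobnorm (F b - F a) <= C * (b - a).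
Proof.
move=> ab FD DC; set W := F b - F a.
have fD (s : R) :
    is_derive s (1 : R) (fun x => frobdot (F x) W) (frobdot (D s) W).
  exact: is_derive_frobdot.
have [c cab] : exists2 c, c \in `[a, b]%R &
    frobdot (F b) W - frobdot (F a) W = frobdot (D c) W * (b - a).
  apply: (MVT_segment ab (fun x _ => fD x)).
  by apply: derivable_within_continuous => x _; case: (fD x).
rewrite -frobdotBl -/W -frobnorm_sqr => WE.
have := frobdot_le (D c) W.
have {}/DC Dc : a <= c <= b by rewrite in_itv/= in cab.
have [->|W0] := eqVneq (frobnorm W) 0.
  by rewrite mulr_ge0 ?subr_ge0// (le_trans _ Dc) ?frobnorm_ge0.
have {W0}Wgt0 : 0 < frobnorm W by rewrite lt_def W0 frobnorm_ge0.
move=> DW; rewrite -(ler_pM2r Wgt0) -expr2 WE mulrAC ler_wpM2r ?subr_ge0//.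
by apply: le_trans (ler_norm _) (le_trans DW _); rewrite ler_pM2r.
Qed.

(** The two difference quotients are literally the same function of the increment. *)
Lemma is_derive_line (V W : normedModType R) (f : V -> W) y v (t : R) D :
  is_derive t (1 : R) (fun s => f (y + s *: v)) D <->
  is_derive (y + t *: v) v f D.
Proof.
suff E :
  (fun h : R => h^-1 *: (((fun s => f (y + s *: v)) \o shift t) (h *: 1) -
    f (y + t *: v))) =
    (fun h => h^-1 *: ((f \o shift (y + t *: v)) (h *: v) - f (y + t *: v))).
  by split=> -[d e]; split; rewrite /derivable /derive in d e *;
    rewrite ?E// -?E.
apply/funext => h /=; congr (_ *: (f _ - _)).
by rewrite [h *: 1]mulr1 scalerDl addrCA.
Qed.

(** Both sides are the derivative at [s] of x |-> exp(x A), once through [is_derive_expmx] and once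
    through the power series. *)
Lemma dexpmxZ n (A : 'M[R]_n) s : dexpmx (s *: A) A = A *m expmx (s *: A).
Proof.
have d := is_derive_expmx (0 + s *: A) A; rewrite {2}add0r in d.
have {d}/is_derive_line[_ <-] := d.
rewrite (_ : (fun x => _) = fun x : R => expmx (x *: A)); last first.
  by apply/funext => x; rewrite add0r.
by have [_ ->] := is_derive_expmxZ A s.
Qed.

Definition expmx_interp n (A B : 'M[R]_n) (s : R) : 'M[R]_n :=
  expmx (s *: A) *m expmx ((1 - s) *: B).

Lemma expmx_interp0 n (A B : 'M[R]_n) : expmx_interp A B 0 = expmx B.
Proof. by rewrite /expmx_interp scale0r expmx0 mul1mx subr0 scale1r. Qed.

Lemma expmx_interp1 n (A B : 'M[R]_n) : expmx_interp A B 1 = expmx A.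
Proof. by rewrite /expmx_interp scale1r subrr scale0r expmx0 mulmx1. Qed.

Lemma is_derive_expmx_interp n (A B : 'M[R]_n) s :
  is_derive s (1 : R) (expmx_interp A B)
    (expmx (s *: A) *m (A - B) *m expmx ((1 - s) *: B)).
Proof.
have dA := is_derive_expmxZ A s.
have dB : is_derive s (1 : R) (fun x => expmx ((1 - x) *: B))
    (- (B *m expmx ((1 - s) *: B))).
  rewrite (_ : (fun x => _) = fun x : R => expmx (B + x *: - B)).
    apply/is_derive_line; rewrite -dexpmxZ.
    rewrite (_ : B + s *: - B = (1 - s) *: B).
      apply: is_derive_eq; first exact: is_derive_expmx.
      by rewrite linearN.
    by rewrite scalerN scalerBl scale1r.
  by apply/funext => x; rewrite scalerN scalerBl scale1r.
apply: is_derive_eq; first exact: is_derive_mulmx dA dB.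
(* Moving [A] to the right of exp(s A) lets the two terms of the product rule merge into one factor
   [A - B]. *)
rewrite (expmx_comm (A := s *: A) (B := A)).
  by rewrite mulmxN addrC mulmxBr mulmxBl !mulmxA.
by rewrite -scalemxAl -scalemxAr.
Qed.

Lemma is_derive_mulmx_cst m n p q (F : R -> 'M[R]_(n, p)) s D
    (P : 'M[R]_(m, n)) (Q : 'M[R]_(p, q)) :
  is_derive s (1 : R) F D ->
  is_derive s (1 : R) (fun x => P *m F x *m Q) (P *m D *m Q).
Proof.
move=> FD; apply: is_derive_eq.
  apply: is_derive_mulmx (is_derive_cst Q _ _).
  exact: is_derive_mulmx (is_derive_cst P _ _) FD.
by rewrite mul0mx addr0 mulmx0 add0r.
Qed.

(** [P] and [Q] may be rectangular: besides framing the difference by further factors, they can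
    select a row or a block of it. *)
Lemma expmx_sub_le m n q (A B : 'M[R]_n) (P : 'M[R]_(m, n))
    (Q : 'M[R]_(n, q)) C :
  (forall s, 0 <= s <= 1 ->
   frobnorm (P *m (expmx (s *: A) *m (A - B) *m expmx ((1 - s) *: B)) *m Q)
     <= C) ->
  frobnorm (P *m (expmx A - expmx B) *m Q) <= C.
Proof.
move=> PQ; have := mean_value_frobnorm ler01
  (fun s => is_derive_mulmx_cst P Q (is_derive_expmx_interp A B s)) PQ.
by rewrite expmx_interp0 expmx_interp1 -mulmxBl -mulmxBr subr0 mulr1.
Qed.

(** The identity factors give each summand the shape P (X - X') Q required by [expmx_sub_le]. *)
Lemma mulmx3_sub n (X X' K Y Y' : 'M[R]_n) :
  X *m K *m Y - X' *m K *m Y' =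
  1%:M *m (X - X') *m (K *m Y) + (X' *m K) *m (Y - Y') *m 1%:M.
Proof. by rewrite mul1mx mulmx1 mulmxBl mulmxBr !mulmxA addrA subrK. Qed.

(** The paths joining exp A to exp(A + e K) and exp B to exp(B + e K) are compared. Their
    derivatives carry a factor [e], and the difference of these derivatives splits into two
    differences of exponentials, each at most [C] by a second use of the mean value inequality. *)
Lemma expmx_second_diff n (A B K : 'M[R]_n) e C :
  (forall s u, 0 <= s <= 1 -> 0 <= u <= 1 ->
    frobnorm (expmx (u *: (s *: (A + e *: K))) *m (A - B) *m
      (expmx ((1 - u) *: (s *: (B + e *: K))) *m K *m expmx ((1 - s) *: A)))
      <= C) ->
  (forall s u, 0 <= s <= 1 -> 0 <= u <= 1 ->
    frobnorm (expmx (s *: (B + e *: K)) *m K *m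
      (expmx (u *: ((1 - s) *: A)) *m (A - B) *m
       expmx ((1 - u) *: ((1 - s) *: B)))) <= C) ->
  frobnorm (expmx (A + e *: K) - expmx A - (expmx (B + e *: K) - expmx B)) <=
  `|e| * (2 * C).
Proof.
move=> CA CB.
pose F Z := expmx_interp (Z + e *: K) Z.
pose F' Z (s : R) := expmx (s *: (Z + e *: K)) *m K *m expmx ((1 - s) *: Z).
have FD Z (s : R) : is_derive s (1 : R) (F Z) (e *: F' Z s).
  apply: is_derive_eq; first exact: is_derive_expmx_interp.
  by rewrite addrAC subrr add0r -scalemxAr -scalemxAl.
have F10 Z : F Z 1 - F Z 0 = expmx (Z + e *: K) - expmx Z.
  by rewrite /F expmx_interp0 expmx_interp1.
rewrite -(F10 A) -(F10 B) subrACA.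
rewrite -[leRHS]mulr1 -[X in _ <= _ * X]subr0.
apply: (@mean_value_frobnorm _ _ (fun s => F A s - F B s)
  (fun s => e *: F' A s - e *: F' B s)) => // s s01.
have {CA}CA u := CA s u s01; have {CB}CB u := CB s u s01.
have /andP[s0 s1] := s01.
rewrite -scalerBr frobnormZ ler_wpM2l// /F' mulr2n mulrDl mul1r.
set X := expmx (s *: (A + _)); set X' := expmx (s *: (B + _)).
set Y := expmx ((1 - s) *: A); set Y' := expmx ((1 - s) *: B).
rewrite (mulmx3_sub X X'); apply: le_trans (frobnormD _ _) _.
apply: lerD; apply: expmx_sub_le => u u01.
(* The terms [e *: K] cancel, leaving s (A - B); the factor [s], at most 1, is dropped. The other
   summand is treated alike with 1 - s. *)
- rewrite mul1mx -scalerBr opprD addrACA subrr addr0.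
  rewrite -scalemxAr -!scalemxAl; apply: frobnormZ_le => //.
  by rewrite -mulmxA (mulmxA (expmx _) K); exact: CA.
- rewrite mulmx1 -scalerBr -scalemxAr -scalemxAl -scalemxAr.
  apply: frobnormZ_le; last exact: CB.
  by rewrite subr_ge0 s1 gerBl.
Qed.

(** For equal endpoints the interpolation has zero derivative, hence is constant; its values at 0
    and 1/2 are compared. *)
Lemma expmx_half n (A : 'M[R]_n) :
  expmx A = expmx (2^-1 *: A) *m expmx (2^-1 *: A).
Proof.
have h01 : 0 <= 2^-1 :> R by rewrite invr_ge0.
have := mean_value_frobnorm h01 (is_derive_expmx_interp A A) (C := 0).
rewrite expmx_interp0 mul0r /expmx_interp.
rewrite (_ : 1 - 2^-1 = 2^-1 :> R); last by field.
move=> E; apply/esym/eqP; rewrite -subr_eq0; apply/eqP/frobnorm_le0.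
by apply: E => s _; rewrite subrr mulmx0 mul0mx frobnorm0.
Qed.

End MeanValue.

(** * Rigid motions *)

Section SpecialEuclidean.
Context {R : realType}.

Lemma frobdot_cV3 (a b : 'cV[R]_3) :
  frobdot a b = a 0 0 * b 0 0 + a 1 0 * b 1 0 + a 2 0 * b 2 0.
Proof.
rewrite /frobdot !big_ord_recl !big_ord0 !addr0 addrA.
by congr (_ * _ + _ * _ + _ * _); congr (_ _ _); apply/val_inj.
Qed.

(** Lagrange's identity for the cross product. *)
Lemma frobdot_cross (w x : 'cV[R]_3) :
  frobdot (cross w x) (cross w x) =
  frobdot w w * frobdot x x - frobdot w x ^+ 2.
Proof. by rewrite !frobdot_cV3 !mxE /=; ring. Qed.

Lemma frobdot_cols m n (A : 'M[R]_(m, n)) :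
  frobdot A A = \sum_j frobdot (col j A) (col j A).
Proof.
rewrite {1}/frobdot exchange_big; apply: eq_bigr => j _.
by apply: eq_bigr => i _; rewrite big_ord1 !mxE.
Qed.

Lemma frobnorm_skew_mul n (w : 'cV[R]_3) (M : 'M[R]_(3, n)) :
  frobnorm (skewmat w *m M) <= frobnorm w * frobnorm M.
Proof.
rewrite frobnorm_le ?mulr_ge0 ?frobnorm_ge0// exprMn !frobnorm_sqr.
rewrite !(frobdot_cols (_ *m _)) (frobdot_cols M) mulr_sumr.
apply: ler_sum => j _; rewrite colE -mulmxA -colE skewmatE frobdot_cross.
by rewrite gerBl sqr_ge0.
Qed.

Lemma skewmat_linear : linear (@skewmat R).
Proof.
move=> c u v; apply/matrixP => i j; rewrite !mxE.
by case: i => [[|[|[|//]]] ?] /=; ring.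
Qed.

Lemma trmx_skewmat (w : 'cV[R]_3) : (skewmat w)^T = - skewmat w.
Proof.
apply/matrixP => i j; rewrite !mxE.
by case: i => [[|[|[|//]]] ?]; case: j => [[|[|[|//]]] ?] /=; ring.
Qed.

Lemma frobdot_skewmat (w : 'cV[R]_3) :
  frobdot (skewmat w) (skewmat w) = 2 * frobdot w w.
Proof.
rewrite frobdot_cV3 /frobdot !big_ord_recl !big_ord0 !mxE /=; ring.
Qed.

Lemma se3_linear : linear (@se3 R).
Proof.
move=> c h k; rewrite /se3 !linearP skewmat_linear.
by rewrite scale_block_mx add_block_mx !scaler0 !addr0.
Qed.

HB.instance Definition _ :=
  GRing.isLinear.Build R 'cV[R]_(3 + 3) 'M[R]_(3 + 1) _ (@se3 R) se3_linear.

Lemma se3_exp_scale s (theta : 'cV[R]_(3 + 3)) :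
  expmx (s *: se3 theta) = se3_exp (s *: theta).
Proof. by rewrite /se3_exp linearZ. Qed.

Lemma frobdot_vsub (h : 'cV[R]_(3 + 3)) : frobdot h h =
  frobdot (usubmx h) (usubmx h) + frobdot (dsubmx h) (dsubmx h).
Proof. by rewrite -{1 2}(vsubmxK h) frobdot_col. Qed.

Lemma frobnorm_usubmx (h : 'cV[R]_(3 + 3)) : frobnorm (usubmx h) <= frobnorm h.
Proof.
rewrite frobnorm_le ?frobnorm_ge0// frobnorm_sqr frobdot_vsub.
by rewrite lerDl frobdot_ge0.
Qed.

Lemma frobnorm_dsubmx (h : 'cV[R]_(3 + 3)) : frobnorm (dsubmx h) <= frobnorm h.
Proof.
rewrite frobnorm_le ?frobnorm_ge0// frobnorm_sqr frobdot_vsub.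
by rewrite lerDr frobdot_ge0.
Qed.

Local Notation upper_mx Z := (col_mx Z (0 : 'M[R]_(1, _))).

(** Elements of SE(3) with translation part at most [rho]; [rigid_se3_exp] places the exponentials
    of the ball of radius [rho] here. *)
Definition rigid (rho : R) (G : 'M[R]_(3 + 1)) : Prop :=
  exists Q t, [/\ G = block_mx Q t (0 : 'M[R]_(1, 3)) 1%:M, Q^T *m Q = 1%:M,
    \det Q = 1 & frobnorm t <= rho].

Lemma rigid_SE3 rho G : rigid rho G -> SE3 G.
Proof. by move=> [Q [t [-> QQ dQ _]]]; exists Q => //; exists t. Qed.

Lemma se3_rigidE (h : 'cV[R]_(3 + 3)) Q t :
  se3 h *m block_mx Q t (0 : 'M[R]_(1, 3)) 1%:M =
  block_mx (skewmat (usubmx h) *m Q) (skewmat (usubmx h) *m t + dsubmx h) 0 0.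
Proof. by rewrite mulmx_block !(mulmx0, mul0mx, mulmx1, addr0, add0r). Qed.

(** The translation of [G] meets the zero last row, so only the rotation acts. *)
Lemma rigid_mul_upper n rho G (Z : 'M[R]_(3, n)) : rigid rho G ->
  frobnorm (G *m upper_mx Z) = frobnorm Z.
Proof.
move=> [Q [t [-> QQ _ _]]]; rewrite mul_block_col !(mulmx0, addr0, mul0mx).
rewrite /frobnorm frobdot_col frobdot0l addr0.
exact: frobnorm_orthl.
Qed.

Lemma se3_mul_upper n (h : 'cV[R]_(3 + 3)) (Z : 'M[R]_(3, n)) :
  se3 h *m upper_mx Z = col_mx (skewmat (usubmx h) *m Z) 0.
Proof. by rewrite mul_block_col !(mulmx0, addr0, mul0mx). Qed.

Lemma rigid_se3_upper rho G (h : 'cV[R]_(3 + 3)) G' : rigid rho G ->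
  rigid rho G' -> exists Z, G *m se3 h *m G' = upper_mx Z.
Proof.
move=> [Q [t [-> _ _ _]]] [Q' [t' [-> _ _ _]]].
rewrite -mulmxA se3_rigidE mulmx_block !(mulmx0, addr0, mul0mx).
by rewrite block_mxEv row_mx0; eexists.
Qed.

(** Only the rotational part of [h] acts on a matrix with zero last row, so no factor [rho] appears.
    This keeps the products of two algebra elements linear in [rho]. *)
Lemma frobnorm_rigid_upper n rho G (h : 'cV[R]_(3 + 3)) (Z : 'M[R]_(3, n)) :
  rigid rho G ->
  frobnorm (G *m se3 h *m upper_mx Z) <= frobnorm h * frobnorm (upper_mx Z).
Proof.
move=> rG; rewrite -mulmxA se3_mul_upper (rigid_mul_upper _ rG).
apply: le_trans (frobnorm_skew_mul _ _) _.
rewrite [X in _ <= _ * X]/frobnorm frobdot_col frobdot0l addr0.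
by rewrite ler_wpM2r ?frobnorm_ge0// frobnorm_usubmx.
Qed.

Lemma frobnorm_rigid_se3 rho G (h : 'cV[R]_(3 + 3)) G' : 1 <= rho ->
  rigid rho G -> rigid rho G' ->
  frobnorm (G *m se3 h *m G') <= 2 * rho * frobnorm h.
Proof.
move=> rho1 rG [Q [t [-> QQ _ trho]]].
have rho0 : 0 <= rho by exact: le_trans ler01 rho1.
rewrite -mulmxA se3_rigidE block_mxEv row_mx0 (rigid_mul_upper _ rG).
set w := usubmx h; set v := dsubmx h.
rewrite frobnorm_le ?mulr_ge0 ?frobnorm_ge0// exprMn frobnorm_sqr frobdot_vsub.
rewrite -/w -/v -!frobnorm_sqr.
have -> : frobnorm (row_mx (skewmat w *m Q) (skewmat w *m t + v)) ^+ 2 =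
    2 * frobnorm w ^+ 2 + frobnorm (skewmat w *m t + v) ^+ 2.
  rewrite frobnorm_sqr frobdot_row -!frobnorm_sqr (frobnorm_orthr _ QQ).
  by congr (_ + _); rewrite !frobnorm_sqr frobdot_skewmat.
have b : frobnorm (skewmat w *m t + v) <= frobnorm w * rho + frobnorm v.
  apply: le_trans (frobnormD _ _) _; rewrite lerD2r.
  apply: le_trans (frobnorm_skew_mul _ _) _.
  by rewrite ler_wpM2l ?frobnorm_ge0.
have := frobnorm_ge0 (skewmat w *m t + v).
move: (frobnorm_ge0 w) (frobnorm_ge0 v) b.
move: (frobnorm (_ + _)) (frobnorm w) (frobnorm v) => x a c a0 c0 b x0.
have : x ^+ 2 <= (a * rho + c) ^+ 2.
  by rewrite ler_sqr ?nnegrE ?addr_ge0 ?mulr_ge0.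
(* The goal is 2 a^2 + (a rho + c)^2 <= 4 rho^2 (a^2 + c^2). This square absorbs the cross term 2 a
   rho c into a^2 + rho^2 c^2, and rho >= 1 gives 3 + rho^2 <= 4 rho^2. *)
have : 0 <= (a - rho * c) ^+ 2 by exact: sqr_ge0.
have : 1 <= rho ^+ 2 by rewrite exprn_ege1.
nra.
Qed.

Lemma frobnorm_rigid_se3_2 rho G (h k : 'cV[R]_(3 + 3)) G1 G2 : 1 <= rho ->
  rigid rho G -> rigid rho G1 -> rigid rho G2 ->
  frobnorm (G *m se3 h *m (G1 *m se3 k *m G2)) <=
  frobnorm h * (2 * rho * frobnorm k).
Proof.
move=> rho1 rG rG1 rG2; have := frobnorm_rigid_se3 k rho1 rG1 rG2.
have [Z ->] := rigid_se3_upper k rG1 rG2 => ZE.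
apply: le_trans (frobnorm_rigid_upper _ _ rG) _.
by rewrite ler_wpM2l ?frobnorm_ge0.
Qed.

End SpecialEuclidean.

(** * The exponential of se(3): values in SE(3), first and second differences *)

Section ExponentialEstimates.
Context {R : realType}.
Implicit Types theta h k : 'cV[R]_(3 + 3).

Lemma drow_se3_exp theta :
  dsubmx (se3_exp theta) = row_mx (0 : 'M[R]_(1, 3)) 1%:M.
Proof.
set r := row_mx _ _.
have rA : r *m se3 theta = 0.
  by rewrite mul_row_block !(mul0mx, mulmx0, addr0) row_mx0.
(* The last row [r] of the identity is annihilated by [se3 theta], so the bound holds with constant
   0 and [r] is fixed by the exponential. *)
have := @expmx_sub_le R _ _ _ 0 (se3 theta) r 1%:M 0.
rewrite expmx0 mulmx1 mulmxBr mulmx1 => /(_ _)/frobnorm_le0 E.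
suff {1}-> : r = r *m se3_exp theta.
  by rewrite -[se3_exp theta]vsubmxK mul_row_col mul0mx add0r mul1mx col_mxKd.
apply/eqP; rewrite -subr_eq0; apply/eqP/E => s _.
by rewrite scaler0 expmx0 mul1mx sub0r mulNmx mulmxN mulmxA rA mul0mx oppr0
  mul0mx frobnorm0.
Qed.

Lemma se3_expE theta : exists Q t,
  se3_exp theta = block_mx Q t (0 : 'M[R]_(1, 3)) 1%:M.
Proof.
exists (ulsubmx (se3_exp theta)), (ursubmx (se3_exp theta)).
by rewrite -[LHS]submxK /dlsubmx /drsubmx drow_se3_exp row_mxKl row_mxKr.
Qed.

(** The rotation block satisfies q' = W q with [W] skew-symmetric, so q^T q has zero derivative and
    keeps its value at 0, the identity. *)
Lemma ulsubmx_se3_exp_orth theta :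
  (ulsubmx (se3_exp theta))^T *m ulsubmx (se3_exp theta) = 1%:M.
Proof.
set A := se3 theta; set W := skewmat (usubmx theta).
pose q (s : R) := ulsubmx (expmx (s *: A)).
have qD (s : R) : is_derive s (1 : R) q (W *m q s).
  apply/is_derive_mxP => i j.
  have /is_derive_mxP/(_ (lshift 1 i) (lshift 1 j)) := is_derive_expmxZ A s.
  rewrite /q se3_exp_scale; have [Q [t ->]] := se3_expE (s *: theta).
  rewrite se3_rigidE block_mxEul block_mxKul => AD.
  rewrite (_ : (fun x => _) =
    fun x => expmx (x *: A) (lshift 1 i) (lshift 1 j))//.
  by apply/funext => x; rewrite !mxE.
have qTD (s : R) : is_derive s (1 : R) (fun x => (q x)^T) (W *m q s)^T.
  apply/is_derive_mxP => i j; rewrite mxE.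
  rewrite (_ : (fun x => _) = fun x => q x j i); last first.
    by apply/funext => x; rewrite mxE.
  by have /is_derive_mxP := qD s.
have D (s : R) : is_derive s (1 : R) (fun x => (q x)^T *m q x) 0.
  apply: is_derive_eq; first exact: is_derive_mulmx (qTD s) (qD s).
  by rewrite trmx_mul trmx_skewmat mulmxN mulNmx mulmxA subrr.
have := @mean_value_frobnorm R _ _ _ _ 0 1 0 ler01 D.
rewrite mul0r => /(_ _)/frobnorm_le0 E.
rewrite [RHS](_ : _ = (q 0)^T *m q 0); last first.
  by rewrite /q scale0r expmx0 scalar_mx_block block_mxKul trmx1 mul1mx.
rewrite -[se3_exp _]/(expmx A) -[A in LHS]scale1r.
apply/eqP; rewrite -subr_eq0; by apply/eqP/E => s _; rewrite frobnorm0.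
Qed.

(** The block is the square of the one at half of [theta], so its determinant is the square of an
    orthogonal determinant; no connectedness argument is involved. *)
Lemma det_ulsubmx_se3_exp theta : \det (ulsubmx (se3_exp theta)) = 1.
Proof.
have -> : ulsubmx (se3_exp theta) =
    ulsubmx (se3_exp (2^-1 *: theta)) *m ulsubmx (se3_exp (2^-1 *: theta)).
  rewrite {1}/se3_exp expmx_half se3_exp_scale.
  have [Q [t ->]] := se3_expE (2^-1 *: theta).
  by rewrite mulmx_block !block_mxKul mulmx0 addr0.
have := congr1 determinant (ulsubmx_se3_exp_orth (2^-1 *: theta)).
by rewrite det_mulmx det_tr det1 det_mulmx.
Qed.

Lemma frobnorm_ursubmx_se3_exp theta :
  frobnorm (ursubmx (se3_exp theta)) <= frobnorm theta.
Proof.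
pose P := row_mx (1%:M : 'M[R]_3) (0 : 'M[R]_(3, 1)).
pose Q := col_mx (0 : 'M[R]_(3, 1)) (1%:M : 'M[R]_1).
have ursubE (M : 'M[R]_(3 + 1)) : P *m M *m Q = ursubmx M.
  rewrite -[M in LHS]submxK mul_row_block mul_row_col.
  by rewrite !(mul0mx, mul1mx, addr0, mulmx0, mulmx1, add0r).
(* Compared with exp 0, whose translation block is 0, the path has derivative block q v, with q a
   rotation and v the lower half of [theta]. *)
have := @expmx_sub_le R _ _ _ (se3 theta) 0 P Q (frobnorm theta).
rewrite expmx0 mulmxBr mulmxBl !ursubE.
rewrite (_ : ursubmx 1%:M = 0) ?subr0 ?subr0; last first.
  by rewrite scalar_mx_block block_mxKur.
apply => s s01; rewrite ursubE scaler0 expmx0 mulmx1 se3_exp_scale.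
have := ulsubmx_se3_exp_orth (s *: theta).
have [q [t ->]] := se3_expE (s *: theta).
rewrite block_mxKul mulmx_block block_mxKur mulmx0 addr0 => qq.
by rewrite frobnorm_orthl// frobnorm_dsubmx.
Qed.

Lemma rigid_se3_exp rho theta :
  frobnorm theta <= rho -> rigid rho (se3_exp theta).
Proof.
move=> trho; exists (ulsubmx (se3_exp theta)), (ursubmx (se3_exp theta)); split.
- by have [Q [t ->]] := se3_expE theta; rewrite block_mxKul block_mxKur.
- exact: ulsubmx_se3_exp_orth.
- exact: det_ulsubmx_se3_exp.
- exact: le_trans (frobnorm_ursubmx_se3_exp _) trho.
Qed.

Lemma rigid_expmx_se3 rho theta s : 0 <= s <= 1 -> frobnorm theta <= rho ->
  rigid rho (expmx (s *: se3 theta)).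
Proof.
by move=> s01 tr; rewrite se3_exp_scale; exact/rigid_se3_exp/frobnormZ_le.
Qed.

Lemma onem01 (s : R) : 0 <= s <= 1 -> 0 <= 1 - s <= 1.
Proof. by move=> /andP[s0 s1]; rewrite subr_ge0 s1 gerBl. Qed.

Section BallEstimates.
Variable rho : R.
Hypothesis rho1 : 1 <= rho.

Lemma se3_exp_lipschitz theta theta' :
  frobnorm theta <= rho -> frobnorm theta' <= rho ->
  frobnorm (se3_exp theta - se3_exp theta') <=
  2 * rho * frobnorm (theta - theta').
Proof.
move=> tr tr'; rewrite -[_ - se3_exp _]mul1mx -[_ *m (_ - _)]mulmx1.
apply: expmx_sub_le => s s01; rewrite mul1mx mulmx1 -linearB.
by apply: frobnorm_rigid_se3 => //; apply: rigid_expmx_se3 => //; exact: onem01.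
Qed.

(** [expmx_second_diff] leaves products of two algebra elements, [theta - theta'] and [k], in either
    order between rigid motions; both orders have the same bound. All four points lie in the ball,
    so every exponential involved is rigid with the same [rho]. *)
Lemma se3_exp_second_diff theta theta' k e :
  frobnorm theta <= rho -> frobnorm theta' <= rho ->
  frobnorm (theta + e *: k) <= rho -> frobnorm (theta' + e *: k) <= rho ->
  frobnorm (se3_exp (theta + e *: k) - se3_exp theta -
            (se3_exp (theta' + e *: k) - se3_exp theta')) <=
  `|e| * (2 * (2 * rho * frobnorm (theta - theta') * frobnorm k)).
Proof.
move=> tr tr' tkr tkr'.
have s01' (s : R) : 0 <= s <= 1 -> 0 <= 1 - s <= 1 by exact: onem01.
have rig (s u : R) t : 0 <= s <= 1 -> 0 <= u <= 1 -> frobnorm t <= rho ->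
    rigid rho (expmx (u *: (s *: se3 t))).
  move=> s01 u01 trho.
  have -> : s *: se3 t = se3 (s *: t) by rewrite linearZ.
  exact: (rigid_expmx_se3 u01 (frobnormZ_le s01 trho)).
have seE t : se3 (t + e *: k) = se3 t + e *: se3 k by rewrite linearD linearZ.
rewrite /se3_exp !seE.
apply: expmx_second_diff => s u s01 u01; rewrite -!seE -linearB.
- set G := expmx (u *: _); set G1 := expmx ((1 - u) *: _).
  have := @frobnorm_rigid_se3_2 R rho G (theta - theta') k G1
    (expmx ((1 - s) *: se3 theta)) rho1.
  rewrite mulrCA mulrA; apply.
  + exact: rig.
  + exact: rig (s01' _ u01) _.
  + exact: rigid_expmx_se3 (s01' _ s01) _.
- have := @frobnorm_rigid_se3_2 R rho (expmx (s *: se3 (theta' + e *: k))) k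
    (theta - theta') (expmx (u *: ((1 - s) *: se3 theta)))
    (expmx ((1 - u) *: ((1 - s) *: se3 theta'))) rho1.
  rewrite [_ * (2 * _ * _)]mulrC; apply.
  + exact: rigid_expmx_se3.
  + exact: rig (s01' _ s01) u01 _.
  + exact: rig (s01' _ s01) (s01' _ u01) _.
Qed.

End BallEstimates.
End ExponentialEstimates.

(** * Gradients along curves *)

Section GradientChainRule.
Context {R : realType}.

(** The limit of the quotients is paired with [D] itself and one factor |D| cancelled. The slack |h|
    b leaves room for estimates on a ball that grows with [h]. *)
Lemma frobnorm_derive_le m n (F : R -> 'M[R]_(m, n)) D (a b : R) :
  0 <= a -> 0 <= b ->
  is_derive (0 : R) (1 : R) F D ->
  (forall h, frobnorm (F h - F 0) <= `|h| * (a + `|h| * b)) ->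
  frobnorm D <= a.
Proof.
move=> a0 b0 FD Fab; apply/ler_addgt0Pr => e e0.
have [->|D0] := eqVneq (frobnorm D) 0.
  by rewrite addr_ge0// ltW.
have {D0}Dgt0 : 0 < frobnorm D by rewrite lt_def D0 frobnorm_ge0.
rewrite -(ler_pM2r Dgt0) -expr2 frobnorm_sqr.
have [/= df <-] := is_derive_frobdot D FD.
apply: limr_le => //; near=> h.
have h0 : h != 0 by near: h; exact: nbhs_dnbhs_neq.
have hb : `|h| <= e / (b + 1).
  by near: h; apply: dnbhs0_le; rewrite divr_gt0// ltr_wpDl.
rewrite /= [h *: 1]mulr1 addr0 -frobdotBl -[_ *: frobdot _ _]frobdotZl.
apply: le_trans (ler_norm _) (le_trans (frobdot_le _ _) _).
rewrite ler_pM2r// frobnormZ normfV ler_pdivrMl ?normr_gt0//.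
apply: le_trans (Fab h) _; rewrite ler_wpM2l// lerD2l.
move: hb; rewrite ler_pdivlMr ?ltr_wpDl//; apply: le_trans.
by rewrite ler_wpM2l// lerDl.
Unshelve. all: by end_near. Qed.

Lemma is_derive_comp_grad m n (f : 'M[R]_(m, n) -> R) (g : R -> 'M[R]_(m, n))
    (t : R) D :
  differentiable f (g t) -> is_derive t (1 : R) g D ->
  is_derive t (1 : R) (fun s => f (g s)) (frobdot (grad f (g t)) D).
Proof.
move=> df [dg <-].
have dg' := (derivable1_diffP g t).1 dg.
have dfg : differentiable (f \o g) t by exact: differentiable_comp.
apply: DeriveDef; first exact/derivable1_diffP.
rewrite frobdot_grad// !deriveE//.
by rewrite -[LHS]/('d (f \o g) t 1) diff_comp.
Qed.

(** Entry by entry the Hessian is a differential, hence linear in [H], which its definition by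
    directional derivatives does not show. *)
Lemma hess_entry m n (f : 'M[R]_(m, n) -> R) x H i j :
  (forall v, differentiable (fun y => 'D_v f y) x) ->
  hess f x H i j = 'd (fun y => 'D_(delta_mx i j) f y) x H.
Proof.
move=> df; rewrite /hess.
have gE i' j' : (fun y => grad f y i' j') = (fun y => 'D_(delta_mx i' j') f y).
  by apply/funext => y; rewrite mxE.
rewrite derive_mx; last first.
  by apply/derivable_mxP => i' j'; rewrite gE; exact: diff_derivable.
by rewrite mxE gE deriveE.
Qed.

Lemma is_derive_grad_comp m n (f : 'M[R]_(m, n) -> R) (g : R -> 'M[R]_(m, n))
    (t : R) D :
  (forall v, differentiable (fun y => 'D_v f y) (g t)) ->
  is_derive t (1 : R) g D ->
  is_derive t (1 : R) (fun s => grad f (g s)) (hess f (g t) D).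
Proof.
move=> df gD; apply/is_derive_mxP => i j; rewrite hess_entry//.
rewrite -frobdot_grad// (_ : (fun s => _) =
  (fun s => (fun y => 'D_(delta_mx i j) f y) (g s))); last first.
  by apply/funext => s; rewrite mxE.
exact: is_derive_comp_grad.
Qed.

Lemma frobnorm_hess_le m n (f : 'M[R]_(m, n) -> R) x H M :
  (forall v, differentiable (fun y => 'D_v f y) x) ->
  (opnorm (hess f x) <= M%:E)%E -> frobnorm (hess f x H) <= M * frobnorm H.
Proof.
move=> df fM.
have hZ c (K : 'M[R]_(m, n)) : hess f x (c *: K) = c *: hess f x K.
  apply/matrixP => i j.
  apply: etrans (hess_entry _ _ _ df) _.
  rewrite linearZ; apply/esym; rewrite mxE; congr (_ * _).
  exact: hess_entry df.
(* [opnorm] ranges over the unit ball: a nonzero [H] is normalised by homogeneity, and [H = 0] is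
   treated apart. *)
have [H0|H0] := eqVneq (frobnorm H) 0.
  have E : H = 0 *: H by rewrite scale0r; exact: frobnorm_eq0.
  by rewrite H0 mulr0 E hZ scale0r frobnorm0.
have Hgt0 : 0 < frobnorm H by rewrite lt_def H0 frobnorm_ge0.
have V0 : 0 <= (frobnorm H)^-1 by rewrite invr_ge0 frobnorm_ge0.
rewrite -ler_pdivrMr// mulrC -[X in X * _](ger0_norm V0) -frobnormZ -hZ.
rewrite -lee_fin; apply: le_trans fM.
apply: ereal_sup_ubound; exists ((frobnorm H)^-1 *: H) => //=.
by rewrite frobnormZ ger0_norm// mulVf.
Qed.

End GradientChainRule.

(** * Gradient of the pullback by the exponential and its Lipschitz bound *)

Section ExponentialGradient.
Context {R : realType}.
Implicit Types theta h k : 'cV[R]_(3 + 3).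

Definition dse3_exp theta k : 'M[R]_(3 + 1) := dexpmx (se3 theta) (se3 k).

Lemma dse3_exp_linear theta : linear (dse3_exp theta).
Proof. by move=> c h k; rewrite /dse3_exp !linearP. Qed.

HB.instance Definition _ theta :=
  GRing.isLinear.Build R 'cV[R]_(3 + 3) 'M[R]_(3 + 1) _ (dse3_exp theta)
    (dse3_exp_linear theta).

Lemma is_derive_se3_exp_line theta k (s : R) :
  is_derive s (1 : R) (fun x => se3_exp (theta + x *: k))
    (dse3_exp (theta + s *: k) k).
Proof.
have E (x : R) : se3 (theta + x *: k) = se3 theta + x *: se3 k.
  by rewrite linearD linearZ.
rewrite /dse3_exp /se3_exp E.
rewrite (_ : (fun x => _) = fun x => expmx (se3 theta + x *: se3 k)).
  by apply/is_derive_line; exact: is_derive_expmx.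
by apply/funext => x; rewrite E.
Qed.

Lemma frobnorm_dse3_exp r theta k : 1 <= r -> frobnorm theta <= r ->
  frobnorm (dse3_exp theta k) <= 2 * r * frobnorm k.
Proof.
move=> r1 tr; have r0 := le_trans ler01 r1.
have d0 := is_derive_se3_exp_line theta k 0.
rewrite scale0r addr0 in d0.
have c0 : 0 <= 2 * frobnorm k * frobnorm k by rewrite !mulr_ge0 ?frobnorm_ge0.
have a0 : 0 <= 2 * r * frobnorm k by rewrite !mulr_ge0 ?frobnorm_ge0.
apply: (frobnorm_derive_le a0 c0 d0) => h; rewrite scale0r addr0.
(* [theta + h *: k] may leave the ball of radius [r], so the estimate is taken on this larger one;
   the excess is quadratic in [h]. *)
pose rho := r + `|h| * frobnorm k.
have hk0 : 0 <= `|h| * frobnorm k by rewrite mulr_ge0 ?frobnorm_ge0.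
have rho1 : 1 <= rho by rewrite (le_trans r1)// lerDl.
have trho : frobnorm theta <= rho by rewrite (le_trans tr)// lerDl.
have tkrho : frobnorm (theta + h *: k) <= rho.
  by rewrite (le_trans (frobnormD _ _))// frobnormZ lerD2r.
apply: le_trans (se3_exp_lipschitz rho1 tkrho trho) _.
rewrite addrAC subrr add0r frobnormZ /rho.
by rewrite le_eqVlt; apply/orP; left; apply/eqP; ring.
Qed.

(** The derivative at 0 of the difference of two exponential curves is bounded through
    [se3_exp_second_diff], again on a ball slightly larger than [r]. *)
Lemma frobnorm_dse3_exp_sub r theta theta' k :
  1 <= r -> frobnorm theta <= r -> frobnorm theta' <= r ->
  frobnorm (dse3_exp theta k - dse3_exp theta' k) <=
  4 * r * frobnorm (theta - theta') * frobnorm k.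
Proof.
move=> r1 tr tr'; have r0 := le_trans ler01 r1.
have d0 := is_derive_se3_exp_line theta k 0.
have d0' := is_derive_se3_exp_line theta' k 0.
rewrite scale0r addr0 in d0; rewrite scale0r addr0 in d0'.
have c0 : 0 <= 4 * frobnorm (theta - theta') * frobnorm k * frobnorm k.
  by rewrite !mulr_ge0 ?frobnorm_ge0.
have a0 : 0 <= 4 * r * frobnorm (theta - theta') * frobnorm k.
  by rewrite !mulr_ge0 ?frobnorm_ge0.
apply: (frobnorm_derive_le a0 c0 (is_deriveB d0 d0')) => h.
rewrite !fctE !scale0r !addr0.
pose rho := r + `|h| * frobnorm k.
have hk0 : 0 <= `|h| * frobnorm k by rewrite mulr_ge0 ?frobnorm_ge0.
have rho1 : 1 <= rho by rewrite (le_trans r1)// lerDl.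
have le_rho t : frobnorm t <= r ->
    frobnorm t <= rho /\ frobnorm (t + h *: k) <= rho.
  move=> tler; rewrite (le_trans tler) ?lerDl//; split=> //.
  by rewrite (le_trans (frobnormD _ _))// frobnormZ lerD2r.
have [t1 t2] := le_rho _ tr; have [t1' t2'] := le_rho _ tr'.
rewrite (subrACA (se3_exp (theta + h *: k))).
apply: le_trans (se3_exp_second_diff rho1 t1 t1' t2 t2') _.
rewrite ler_wpM2l// /rho.
by rewrite le_eqVlt; apply/orP; left; apply/eqP; ring.
Qed.

Section Gradient.
Variables (Jt : 'M[R]_(3 + 1) -> R) (J : 'cV[R]_(3 + 3) -> R).
Hypothesis JE : forall theta, J theta = Jt (se3_exp theta).
Hypothesis dJt : forall G, SE3 G -> differentiable Jt G.

Lemma se3_exp_SE3 theta : SE3 (se3_exp theta).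
Proof. exact: rigid_SE3 (rigid_se3_exp (lexx (frobnorm theta))). Qed.

(** The chain rule along lines gives the entries of [grad J theta]; linearity of [dse3_exp theta]
    extends the formula to every [k]. *)
Lemma frobdot_grad_se3_exp theta k :
  frobdot (grad J theta) k =
  frobdot (grad Jt (se3_exp theta)) (dse3_exp theta k).
Proof.
have DJ h : 'D_h J theta =
    frobdot (grad Jt (se3_exp theta)) (dse3_exp theta h).
  have d0 := is_derive_se3_exp_line theta h 0.
  rewrite scale0r addr0 in d0.
  have /is_derive_comp_grad/(_ d0) :
      differentiable Jt (se3_exp (theta + 0 *: h)).
    by apply: dJt; exact: se3_exp_SE3.
  rewrite scale0r addr0 (_ : (fun x => _) = fun x : R => J (theta + x *: h)).
    by move/is_derive_line; rewrite scale0r addr0 => -[].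
  by apply/funext => x; rewrite JE.
rewrite [X in dse3_exp _ X]matrix_sum_delta linear_sum frobdot_sumr.
apply: eq_bigr => i _; rewrite linear_sum frobdot_sumr.
apply: eq_bigr => j _; rewrite linearZ frobdotZr mxE DJ.
exact: mulrC.
Qed.

Hypothesis ddJt : forall G v, SE3 G -> differentiable (fun y => 'D_v Jt y) G.
Variables (M1 M2 r : R).
Hypothesis M2_ge0 : 0 <= M2.
Hypothesis r_ge1 : 1 <= r.
Hypothesis grad_le : forall theta, frobnorm theta <= r ->
  frobnorm (grad Jt (se3_exp theta)) <= M1.
Hypothesis hess_le : forall theta, frobnorm theta <= r ->
  (opnorm (hess Jt (se3_exp theta)) <= M2%:E)%E.

(** The mean value inequality is applied along the image of the segment from [theta'] to [theta],
    where the Hessian bound holds because the ball is convex. *)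
Lemma grad_se3_exp_lipschitz theta theta' :
  frobnorm theta <= r -> frobnorm theta' <= r ->
  frobnorm (grad Jt (se3_exp theta) - grad Jt (se3_exp theta')) <=
  M2 * (2 * r * frobnorm (theta - theta')).
Proof.
move=> tr tr'; pose g (s : R) := se3_exp (theta' + s *: (theta - theta')).
have -> : se3_exp theta = g 1 by rewrite /g scale1r addrC subrK.
have -> : se3_exp theta' = g 0 by rewrite /g scale0r addr0.
rewrite -[leRHS]mulr1 -[X in _ <= _ * X]subr0.
have gD (s : R) : is_derive s (1 : R) (fun s => grad Jt (g s))
    (hess Jt (g s)
      (dse3_exp (theta' + s *: (theta - theta')) (theta - theta'))).
  apply: is_derive_grad_comp; last exact: is_derive_se3_exp_line.
  by move=> v; apply: ddJt; exact: se3_exp_SE3.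
apply: (mean_value_frobnorm ler01 gD) => s s01.
have sr : frobnorm (theta' + s *: (theta - theta')) <= r.
  exact: frobnorm_convex.
apply: le_trans (frobnorm_hess_le _ _ (hess_le sr)) _.
  by move=> v; apply: ddJt; exact: se3_exp_SE3.
by rewrite ler_wpM2l//; exact: frobnorm_dse3_exp.
Qed.

Lemma grad_pullback_lipschitz theta theta' :
  frobnorm theta <= r -> frobnorm theta' <= r ->
  frobnorm (grad J theta - grad J theta') <=
  4 * (M1 + M2) * r ^+ 2 * frobnorm (theta - theta').
Proof.
move=> tr tr'; set k := grad J theta - grad J theta'.
set h := theta - theta'.
have [->|k0] := eqVneq (frobnorm k) 0.
  have M1_ge0 : 0 <= M1 := le_trans (frobnorm_ge0 _) (grad_le tr).
  have r0 := le_trans ler01 r_ge1.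
  by rewrite !mulr_ge0 ?frobnorm_ge0 ?addr_ge0 ?exprn_ge0.
have kgt0 : 0 < frobnorm k by rewrite lt_def k0 frobnorm_ge0.
(* The gradient difference [k] is paired with itself, so that one factor |k| cancels at the end. *)
rewrite -(ler_pM2r kgt0) -expr2 frobnorm_sqr {1}/k frobdotBl.
rewrite !frobdot_grad_se3_exp.
set G := grad Jt (se3_exp theta); set G' := grad Jt (se3_exp theta').
set D := dse3_exp theta k; set D' := dse3_exp theta' k.
apply: le_trans (frobdot_sub_le G G' D D') _.
have Gle : frobnorm (G - G') <= M2 * (2 * r * frobnorm h).
  exact: grad_se3_exp_lipschitz.
have Dle : frobnorm D <= 2 * r * frobnorm k by exact: frobnorm_dse3_exp.
have DDle : frobnorm (D - D') <= 4 * r * frobnorm h * frobnorm k.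
  exact: frobnorm_dse3_exp_sub.
have G'le : frobnorm G' <= M1 by exact: grad_le.
have M1_ge0 : 0 <= M1 := le_trans (frobnorm_ge0 G') G'le.
have le1 := ler_pM (frobnorm_ge0 (G - G')) (frobnorm_ge0 D) Gle Dle.
have le2 := ler_pM (frobnorm_ge0 G') (frobnorm_ge0 (D - D')) G'le DDle.
apply: le_trans (lerD le1 le2) _.
have h0 := frobnorm_ge0 h.
move: (frobnorm h) (frobnorm k) h0 kgt0 => a b a0 b0.
(* The first-order term grows only like [r]; since [r] is at least 1, it is raised to r^2 to match
   the Hessian term. *)
have : M1 * (4 * r * a * b) <= M1 * (4 * r ^+ 2 * a * b).
  have rr : r <= r ^+ 2 by rewrite expr2 ler_peMr// (le_trans ler01).
  by rewrite ler_wpM2l// ler_wpM2r ?(ltW b0)// ler_wpM2r// ler_wpM2l.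
lra.
Qed.

End Gradient.
End ExponentialGradient.

Theorem proposition3p4 (R : realType) (M1 M2 : R) (Jt : 'M[R]_(3 + 1) -> R)
    (J : 'cV[R]_(3 + 3) -> R)
    (M1_ge0 : 0 <= M1) (M2_ge0 : 0 <= M2)
    (JE : forall theta : 'cV[R]_(3 + 3), J theta = Jt (se3_exp theta))
    (J_bounded : bounded_class M1 M2 Jt) (r : R) (r_ge1 : 1 <= r) :
  (grad_lip J r
     <= (5 * (Num.sqrt 2 + 1) / 3 * (M1 + M2) * r ^+ 2)%:E)%E.
Proof.
have [[U [Uopen SE3U smJt]] bd] := J_bounded.
have r_gt0 : 0 < r := lt_le_trans ltr01 r_ge1.
have [gradM hessM] := bd r r_gt0.
(* Class C^2 supplies differentiability of [Jt] and of all its directional derivatives. *)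
have [dJt ddJt] := smJt 2%N.
have grad_le theta : frobnorm theta <= r ->
    frobnorm (grad Jt (se3_exp theta)) <= M1.
  move=> tr; rewrite -lee_fin; apply: le_trans gradM.
  by apply: ereal_sup_ubound; exists (se3_exp theta) => //; exists theta.
have hess_le theta : frobnorm theta <= r ->
    (opnorm (hess Jt (se3_exp theta)) <= M2%:E)%E.
  move=> tr; apply: le_trans hessM.
  by apply: ereal_sup_ubound; exists (se3_exp theta) => //; exists theta.
have lip := grad_pullback_lipschitz JE (fun G SG => dJt G (SE3U G SG))
  (fun G v SG => (ddJt v).1 G (SE3U G SG)) M2_ge0 r_ge1 grad_le hess_le.
apply: ge_ereal_sup => _ [theta [theta' [tr tr' neq ->]]].
have ngt0 : 0 < frobnorm (theta - theta').
  rewrite lt_def frobnorm_ge0 andbT; apply/eqP => /frobnorm_eq0/eqP.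
  by rewrite subr_eq0 => /eqP.
rewrite lee_fin ler_pdivrMr//; apply: le_trans (lip _ _ tr tr') _.
rewrite ler_wpM2r ?frobnorm_ge0// ler_wpM2r ?exprn_ge0 ?(ltW r_gt0)//.
rewrite ler_wpM2r ?addr_ge0//.
(* Exactly what 4 <= 5 (sqrt 2 + 1) / 3 amounts to; it holds because 49/25 <= 2. *)
have : 7 / 5 <= Num.sqrt 2 :> R.
  rewrite -[leLHS]ger0_norm; last by lra.
  by rewrite -sqrtr_sqr ler_wsqrtr//; lra.
lra.
Qed.
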